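(* Consider a network with true network matrix $G^0(q)$. Let $j$ be a measured node, and consider a node $i$ that has a directed path to node $j$. Then all transfer functions along that path can be identified if there is no other walk that connects $i$ to $j$.
   Context: Network: a directed graph without self-loops on $\{1,\dots,L\}$, whose topology is known, together with an $L\times L$ matrix $G^0(q)$ of proper real rational transfer functions. $G^0_{ij}$ is the transfer function of the edge from node $j$ to node $i$; $G^0_{ij}\neq 0$ if and only if there is an edge from $j$ to $i$; $G^0_{ii}=0$. There is a delay in every cycle and $I-G^0$ is invertible with $(I-G^0)^{-1}$ proper and stable; $T^0=(I-G^0)^{-1}$. The node signals satisfy $w=G^0w+r$, $y=Cw$, where every node is excited by a known, sufficiently rich signal $r_i$ (mutually uncorrelated), and $C$ is the $p\times L$ selection matrix ($0/1$, one $1$ per row) of the set $\mathcal C$ of $p$ measured nodes. Thus $CT^0$ is known exactly. A matrix $G$ of proper rational transfer functions is consistent with the graph if $G_{ij}=0$ whenever there is no edge from $j$ to $i$. The transfer function of an edge from $l$ to $k$ can be identified if $G_{kl}=G^0_{kl}$ for every $G$ consistent with the graph and satisfying $CT^0(I-G)=C$. A walk is a series of adjacent directed edges (nodes may be repeated); a path is a walk that never passes twice through the same node. *)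

(* Defs.v *)
From HB Require Import structures.
From mathcomp Require Import all_boot all_order all_algebra.
From mathcomp Require Import reals.
From mathcomp Require Import complex.

Set Implicit Arguments.
Unset Strict Implicit.
Unset Printing Implicit Defensive.

Import GRing.Theory Num.Theory.
Local Open Scope ring_scope.

(* Real rational functions of the forward-shift operator q, so that the
   unit delay is q^-1. *)
Notation transfer R := {fraction {poly R}}.

Definition ratio_of (R : realType) (f : transfer R) (n d : {poly R}) : Prop :=
  d != 0 /\ f = tofrac n / tofrac d.

(* The degree of the denominator minus that of the numerator does not depend
   on the representative, so any representative can be used. *)
Definition proper_tf (R : realType) (f : transfer R) : Prop :=
  exists n d, ratio_of f n d /\ (size n <= size d)%N.

Definition strictly_proper_tf (R : realType) (f : transfer R) : Prop :=
  exists n d, ratio_of f n d /\ (size n < size d)%N.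

(* Discrete-time stability: the poles, i.e. the complex roots of the
   denominator of a reduced representative, lie in the open unit disc. *)
Definition stable_tf (R : realType) (f : transfer R) : Prop :=
  exists n d, [/\ ratio_of f n d, coprimep n d &
    forall z : R[i], root (map_poly (real_complex R) d) z -> `|z| < 1].

(* The graph is e : rel 'I_L, where e j i means that there is an edge from j
   to i; the transfer function of that edge is the entry (i, j) of a network
   matrix. *)

Definition network_transfer (R : realType) (L : nat) (G0 : 'M[transfer R]_L)
  : 'M[transfer R]_L := invmx (1%:M - G0).

Record true_network (R : realType) (L : nat) (e : rel 'I_L)
    (G0 : 'M[transfer R]_L) : Prop := TrueNetwork {
  tn_loopless : irreflexive e;
  tn_proper : forall i j, proper_tf (G0 i j);
  tn_graph : forall i j, (G0 i j != 0) = e j i;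
  tn_delay : forall c : seq 'I_L, c != [::] -> cycle e c -> uniq c ->
    exists2 l, l \in c & strictly_proper_tf (G0 (next c l) l);
  tn_unit : 1%:M - G0 \in unitmx;
  tn_inv_proper : forall i j, proper_tf (network_transfer G0 i j);
  tn_inv_stable : forall i j, stable_tf (network_transfer G0 i j)
}.

(* The order in which the measured nodes are listed is left arbitrary. *)
Definition selection_mx_of (R : realType) (L p : nat) (M : {set 'I_L})
    (C : 'M[transfer R]_(p, L)) : Prop :=
  exists s : 'I_p -> 'I_L, [/\ injective s,
    M = [set s a | a : 'I_p] & C = \matrix_(a, b) (s a == b)%:R].

Definition consistent (R : realType) (L : nat) (e : rel 'I_L)
    (G : 'M[transfer R]_L) : Prop :=
  (forall i j, proper_tf (G i j)) /\ (forall i j, ~~ e j i -> G i j = 0).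

Definition edge_identifiable (R : realType) (L p : nat) (e : rel 'I_L)
    (C : 'M[transfer R]_(p, L)) (G0 : 'M[transfer R]_L) (l k : 'I_L) : Prop :=
  forall G : 'M[transfer R]_L, consistent e G ->
    C *m network_transfer G0 *m (1%:M - G) = C -> G k l = G0 k l.

(* The graph has at most one edge from a node to another, so a walk is
   determined by its nodes; s lists those after the starting node i. *)
Definition is_walk (L : nat) (e : rel 'I_L) (i : 'I_L) (s : seq 'I_L)
    (j : 'I_L) : bool := path e i s && (last i s == j).

Definition is_path (L : nat) (e : rel 'I_L) (i : 'I_L) (s : seq 'I_L)
    (j : 'I_L) : bool := is_walk e i s j && uniq (i :: s).

Definition walk_edges (L : nat) (i : 'I_L) (s : seq 'I_L)
  : seq ('I_L * 'I_L) := zip (i :: s) s.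

(* Main.v *)
Require Import Defs.
From mathcomp Require Import all_boot all_order all_algebra.
From mathcomp Require Import reals.

Set Implicit Arguments.
Unset Strict Implicit.
Unset Printing Implicit Defensive.

Import GRing.Theory.

(** Let [t] be the row of [T0 = (I - G0)^-1] that belongs to the measured
    node [j].  The data give [t (I - G0) = e_j], and [t (I - G) = e_j] for
    every candidate [G]; read at the column of a node [a], either equation
    says that [t_a] is [1] or [0], according to whether [a] is [j], plus the
    sum of the [t_b * G_ba] over the out-neighbours [b] of [a].

    A term of that sum can only be nonzero if [b] leads to [j], because an
    invertible [I - G0] has an inverse that respects reachability
    ([invmx_support]).  If the walk from [a] to [j] is unique, the only such
    [b] is the next node [k] on it, so that the equation collapses to
    [t_a = t_k * G_ka], both for [G] and for [G0] ([unique_walk_step]).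
    Starting from [t_j = 1] and going backwards along the walk, every [t_a]
    on it is nonzero because [G0] does not vanish on edges
    ([unique_walk_neq0]).  Hence [t_k] can be cancelled and
    [G_ka = t_a / t_k = G0_ka] on every edge of the walk. *)

Local Open Scope ring_scope.

(** * Reachability and matrix inversion *)

(** The row vectors supported on the nodes that lead to [j] form a subspace
    stable under right multiplication by [N].  It has finite dimension and [N]
    is injective, so it is also stable under the inverse of [N]; it contains
    the basis vector of [j], hence row [j] of the inverse. *)
Lemma invmx_support (F : fieldType) (L : nat) (e : rel 'I_L) (N : 'M[F]_L) :
    N \in unitmx -> (forall a b, N b a != 0 -> connect e a b) ->
  forall j b, invmx N j b != 0 -> connect e b j.
Proof.
move=> Nu Ne j b.
(* The row space of this diagonal projection is the stable subspace. *)
pose D : 'M[F]_L := diag_mx (\row_a (connect e a j)%:R).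
have DE a c : D a c = (connect e a j && (a == c))%:R.
  by rewrite !mxE; case: (connect _ _ _); case: eqP.
have DN : (D *m N <= D)%MS.
  suff -> : D *m N = D *m N *m D by apply: submxMl.
  apply/matrixP => a c; rewrite mul_mx_diag mul_diag_mx !mxE.
  case aj: (connect e a j); last by rewrite !mul0r.
  have [->|/Ne ca] := eqVneq (N a c) 0; first by rewrite mulr0 mul0r.
  by rewrite (connect_trans ca aj) mulr1.
have ND : (D <= D *m N)%MS.
  by rewrite -(mxrank_leqif_sup DN) mxrankMfree // row_free_unit.
have DV : (D *m invmx N <= D)%MS by have := submxMr (invmx N) ND; rewrite mulmxK.
have /submxP[X XE] : (row j (D *m invmx N) <= D)%MS.
  exact: submx_trans (row_sub _ _) DV.
have := congr1 (fun v : 'rV_L => v 0 b) XE.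
rewrite [LHS]mxE mul_diag_mx mul_mx_diag !mxE connect0 mul1r => ->.
by case: (connect e b j); rewrite // mulr0 eqxx.
Qed.

(** * Following a unique walk *)

Lemma unique_walk_tail (L : nat) (e : rel 'I_L) (a k j : 'I_L)
    (s : seq 'I_L) :
    e a k -> (forall t, is_walk e a t j -> t = k :: s) ->
  forall t, is_walk e k t j -> t = s.
Proof.
move=> ak ua t kt; have [] // : k :: t = k :: s.
by apply: ua; move: kt; rewrite /is_walk /= ak.
Qed.

Lemma row_equation (F : pzRingType) (L : nat) (G : 'M[F]_L) (t : 'rV[F]_L)
    (j a : 'I_L) :
    t *m (1%:M - G) = delta_mx 0 j ->
  t 0 a = (a == j)%:R + \sum_b t 0 b * G b a.
Proof.
move=> /(congr1 (fun v : 'rV_L => v 0 a)).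
rewrite mulmxBr mulmx1 !mxE eqxx /= => /eqP.
by rewrite subr_eq => /eqP.
Qed.

Section UniqueWalk.

Variables (F : fieldType) (L : nat) (e : rel 'I_L) (j : 'I_L) (t : 'rV[F]_L).
Hypothesis t_supp : forall b, t 0 b != 0 -> connect e b j.

Lemma unique_walk_end (G : 'M[F]_L) :
    (forall b a, ~~ e a b -> G b a = 0) ->
    t *m (1%:M - G) = delta_mx 0 j ->
    (forall u, is_walk e j u j -> u = [::]) ->
  t 0 j = 1.
Proof.
move=> Ge tG uj; rewrite (row_equation j tG) eqxx big1 ?addr0 // => b _.
have [/Ge->|/negPn jb] := boolP (~~ e j b); first by rewrite mulr0.
have [->|/t_supp/connectP[u bu uE]] := eqVneq (t 0 b) 0; first exact: mul0r.
(* Otherwise there is a cycle through [j]. *)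
by have /uj : is_walk e j (b :: u) j by rewrite /is_walk /= jb bu -uE eqxx.
Qed.

(** An out-neighbour of [a] other than [k] either does not lead to [j], and
    then [t] vanishes there, or it starts a second walk. *)
Lemma unique_walk_step (G : 'M[F]_L) (a k : 'I_L) (s : seq 'I_L) :
    (forall b a, ~~ e a b -> G b a = 0) ->
    t *m (1%:M - G) = delta_mx 0 j ->
    (forall u, is_walk e a u j -> u = k :: s) ->
  t 0 a = t 0 k * G k a.
Proof.
move=> Ge tG ua; rewrite (row_equation a tG).
have [aj|_] := eqVneq a j.
  (* The empty walk would be a second one. *)
  by have /ua : is_walk e a [::] j by rewrite /is_walk /= aj.
rewrite add0r (bigD1 k) //= big1 ?addr0 // => b bk.
have [/Ge->|/negPn ab] := boolP (~~ e a b); first by rewrite mulr0.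
have [->|/t_supp/connectP[u bu uE]] := eqVneq (t 0 b) 0; first exact: mul0r.
have /ua[bkE _] : is_walk e a (b :: u) j by rewrite /is_walk /= ab bu -uE eqxx.
by rewrite bkE eqxx in bk.
Qed.

Lemma unique_walk_neq0 (G0 : 'M[F]_L) (s : seq 'I_L) (a : 'I_L) :
    (forall b a, (G0 b a != 0) = e a b) ->
    t *m (1%:M - G0) = delta_mx 0 j ->
    is_walk e a s j -> (forall u, is_walk e a u j -> u = s) ->
  t 0 a != 0.
Proof.
move=> G0E tG0.
have G0e b c : ~~ e c b -> G0 b c = 0 by rewrite -G0E negbK => /eqP.
elim: s a => [|k s IHs] a.
  rewrite /is_walk /= => /eqP-> uj.
  by rewrite (unique_walk_end G0e tG0 uj) oner_neq0.
rewrite {1}/is_walk /= -andbA => /andP[ak ks] ua.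
rewrite (unique_walk_step G0e tG0 ua) mulf_neq0 ?G0E //.
exact: IHs ks (unique_walk_tail ak ua).
Qed.

Lemma unique_walk_identified (G0 G : 'M[F]_L) (s : seq 'I_L) (a : 'I_L) :
    (forall b a, (G0 b a != 0) = e a b) ->
    (forall b a, ~~ e a b -> G b a = 0) ->
    t *m (1%:M - G0) = delta_mx 0 j -> t *m (1%:M - G) = delta_mx 0 j ->
    is_walk e a s j -> (forall u, is_walk e a u j -> u = s) ->
  forall l k, (l, k) \in walk_edges a s -> G k l = G0 k l.
Proof.
move=> G0E Ge tG0 tG; elim: s a => [|k s IHs] a // + ua.
have G0e b c : ~~ e c b -> G0 b c = 0 by rewrite -G0E negbK => /eqP.
rewrite /is_walk /= -andbA => /andP[ak ks].
have uk := unique_walk_tail ak ua.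
move=> l m; rewrite /walk_edges /= inE => /orP[/eqP[-> ->]|]; last exact: IHs.
apply: (mulfI (unique_walk_neq0 G0E tG0 ks uk)).
by rewrite -(unique_walk_step Ge tG ua) (unique_walk_step G0e tG0 ua).
Qed.

End UniqueWalk.

(** * Identifiability along the path *)

Theorem mainTheorem6 (R : realType) (L p : nat) (e : rel 'I_L)
    (G0 : 'M[transfer R]_L) (M : {set 'I_L}) (C : 'M[transfer R]_(p, L))
    (i j : 'I_L) (s : seq 'I_L) :
  true_network e G0 ->
  selection_mx_of M C ->
  j \in M ->
  is_path e i s j ->
  (forall t : seq 'I_L, is_walk e i t j -> t = s) ->
  forall l k : 'I_L, (l, k) \in walk_edges i s -> edge_identifiable e C G0 l k.
Proof.
move=> [_ _ G0E _ N0u _ _] [sel [_ -> CE]] /imsetP[c _ jE] /andP[is_s _] us.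
move=> l k lk G [_ Ge] CG.
pose t := row j (network_transfer G0).
have rowC : row c C = delta_mx 0 j.
  by apply/rowP => b; rewrite CE !mxE -jE eqxx eq_sym.
have tG : t *m (1%:M - G) = delta_mx 0 j.
  by rewrite /t rowE -rowC -!row_mul CG.
have tG0 : t *m (1%:M - G0) = delta_mx 0 j.
  by rewrite /t rowE -mulmxA mulVmx // mulmx1.
have t_supp b : t 0 b != 0 -> connect e b j.
  rewrite mxE; apply: invmx_support => // a d; rewrite !mxE.
  have [->|_] := eqVneq d a; first by rewrite connect0.
  by rewrite sub0r oppr_eq0 G0E; apply: connect1.
exact: (unique_walk_identified t_supp G0E Ge tG0 tG is_s us lk).
Qed.
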